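(* The set $S_n(3\mathrm{-}\bar{1}\mathrm{-}42,\,31\mathrm{-}\bar{4}\mathrm{-}2)$ consists of all reverse patience words $\sigma\in\mathfrak{S}_n$ whose $0$-th southwest shadow diagram $D^{(0)}_{SW}(\sigma)$ has no two crossing shadowlines. Moreover, for $\sigma\in S_n(3\mathrm{-}\bar{1}\mathrm{-}42,\,31\mathrm{-}\bar{4}\mathrm{-}2)$, the values in the bottom rows of $R(\sigma)$ and $S(\sigma)$ increase from left to right.
   Context: Extended Patience Sorting: process $\sigma_1,\dots,\sigma_n$; $\sigma_1$ starts pile $r_1$, $s_1=\{1\}$; for $i\ge2$, place $\sigma_i$ on the leftmost pile $r_j$ whose top card is larger than $\sigma_i$ and add $i$ to $s_j$, or, if none exists, start new piles $r_{k+1}=\{\sigma_i\}$, $s_{k+1}=\{i\}$ on the right. $R(\sigma)=(r_1,\dots)$, $S(\sigma)=(s_1,\dots)$; piles decrease from bottom to top; the bottom row consists of the largest element of each pile, in pile order. A reverse patience word is a permutation of the form $RPW(R(\tau))$, $\tau\in\mathfrak{S}_n$, where $RPW$ concatenates the piles $r_1,r_2,\dots$ each written in decreasing order. $\sigma$ contains $3\mathrm{-}\bar{1}\mathrm{-}42$ if there are $i<j<n$ with $\sigma_{j+1}<\sigma_i<\sigma_j$ and no $k$, $i<k<j$, with $\sigma_k<\sigma_{j+1}$. $\sigma$ contains $31\mathrm{-}\bar{4}\mathrm{-}2$ if there are $i<i+1<l$ with $\sigma_{i+1}<\sigma_l<\sigma_i$ and no $k$, $i+1<k<l$, with $\sigma_k>\sigma_i$.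 $S_n(\cdot,\cdot)$ is the set of permutations avoiding both. Southwest shadowline of a finite point set: boundary of the union of the quarter planes $\{(x,y): x\le a, y\le b\}$ over its points $(a,b)$. $D^{(0)}_{SW}(\sigma)$: with $P=\{(i,\sigma_i)\}$, $L_1$ is the shadowline of the points of $P$ whose southwest quarter plane contains no other point of $P$; inductively $L_{j+1}$ is the shadowline of the unused points whose quarter plane contains no other unused point. Two shadowlines cross if they intersect. *)

(* Defs.v *)
From mathcomp Require Import all_boot all_order all_algebra all_fingroup.
From mathcomp Require Import all_classical all_reals all_analysis.

Set Implicit Arguments.
Unset Strict Implicit.
Unset Printing Implicit Defensive.

Import Order.TTheory GRing.Theory Num.Theory.
Import numFieldNormedType.Exports.

Local Open Scope classical_set_scope.
Local Open Scope nat_scope.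

(* Permutations are elements of 'S_n, so positions and values are 0-based
   ordinals. Cards, indices in piles, words and points are 1-based. *)

Definition perm_word (n : nat) (s : 'S_n) : seq nat :=
  [seq (s i).+1 | i <- enum 'I_n].

(* A pair (r_j, s_j); both lists are stacks whose head is the top entry. The
   default value 0 of [head] is never reached, as no pile is ever empty. *)
Fixpoint place (c i : nat) (P : seq (seq nat * seq nat)) :
    seq (seq nat * seq nat) :=
  match P with
  | [::] => [:: ([:: c], [:: i])]
  | rs :: P' =>
      if c < head 0 rs.1 then (c :: rs.1, i :: rs.2) :: P'
      else rs :: place c i P'
  end.

Definition ext_patience (n : nat) (s : 'S_n) : seq (seq nat * seq nat) :=
  foldl (fun P (i : 'I_n) => place (s i).+1 i.+1 P) [::] (enum 'I_n).

Definition Rpiles (n : nat) (s : 'S_n) : seq (seq nat) :=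
  [seq rs.1 | rs <- ext_patience s].

Definition Spiles (n : nat) (s : 'S_n) : seq (seq nat) :=
  [seq rs.2 | rs <- ext_patience s].

Definition bottom_row (P : seq (seq nat)) : seq nat :=
  [seq \max_(x <- p) x | p <- P].

Definition RPW (P : seq (seq nat)) : seq nat :=
  flatten [seq sort geq p | p <- P].

Definition reverse_patience_word (n : nat) (s : 'S_n) : Prop :=
  exists t : 'S_n, perm_word s = RPW (Rpiles t).

Definition contains_3_b1_42 (n : nat) (s : 'S_n) : Prop :=
  exists i j j' : 'I_n,
    [/\ i < j, j' = j.+1 :> nat, s j' < s i < s j
      & ~ exists k : 'I_n, i < k < j /\ s k < s j'].

Definition contains_31_b4_2 (n : nat) (s : 'S_n) : Prop :=
  exists i i' l : 'I_n,
    [/\ i' = i.+1 :> nat, i' < l, s i' < s l < s i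
      & ~ exists k : 'I_n, i' < k < l /\ s i < s k].

Definition avoiders (n : nat) : set 'S_n :=
  [set s | ~ contains_3_b1_42 s /\ ~ contains_31_b4_2 s].
Arguments avoiders : clear implicits.

Section Shadows.
Local Open Scope ring_scope.
Variable R : realType.
Implicit Types (p : R * R) (A P : set (R * R)).

Definition boundary A : set (R * R) := closure A `\` interior A.

Definition sw_quarter p : set (R * R) := [set q | q.1 <= p.1 /\ q.2 <= p.2].

Definition sw_shadowline P : set (R * R) :=
  boundary (\bigcup_(p in P) sw_quarter p).

Definition sw_minimal P : set (R * R) :=
  [set p | P p /\ sw_quarter p `&` P `<=` [set p]].

Definition perm_points (n : nat) (s : 'S_n) : set (R * R) :=
  [set ((i.+1)%:R, ((s i).+1)%:R) | i in [set: 'I_n]].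

(* The points left unused by the first j shadowlines. *)
Definition unused_points (n : nat) (s : 'S_n) (j : nat) : set (R * R) :=
  iter j (fun P => P `\` sw_minimal P) (perm_points s).

(* The shadowline L_(j+1) of the 0-th southwest shadow diagram of s. Once the
   points are exhausted this is the empty set, which crosses nothing. *)
Definition sw_diagram0 (n : nat) (s : 'S_n) (j : nat) : set (R * R) :=
  sw_shadowline (sw_minimal (unused_points s j)).

Definition noncrossing_sw_diagram0 (n : nat) (s : 'S_n) : Prop :=
  forall j k : nat, j <> k -> sw_diagram0 s j `&` sw_diagram0 s k = set0.

End Shadows.

(* Main.v *)
Require Import Defs.
From mathcomp Require Import all_boot all_order all_algebra all_fingroup.
From mathcomp Require Import all_classical all_reals all_analysis.
From mathcomp Require Import zify lra.

(** Everything is read off the ascents of the word f of s. Avoiding 3-\bar{1}-42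
    means that the bottom of every ascent is a right-to-left minimum, and
    avoiding 31-\bar{4}-2 that the top of every ascent is a left-to-right maximum.

    The first condition says that the last letters of the maximal descending runs
    increase. The piles of any permutation have increasing tops, so they are the
    descending runs of their reverse patience word; conversely, under this
    condition patience sorting rebuilds the runs one after the other, so that the
    word is the reverse patience word of its own piles. It also makes the points
    of the (j+1)-st run exactly those used by the shadowline L_(j+1).

    Given the first condition, the second one says that the first letters of the
    runs increase. Then each run lies strictly southwest of the first point of any
    later run, so its shadowline is interior to the later shadow. If it fails, the
    top horizontal ray of the shadowline of some run meets a vertical segment of
    the shadowline of an earlier run. *)

Set Implicit Arguments.
Unset Strict Implicit.
Unset Printing Implicit Defensive.

(** * Ascents and the two patterns *)

Definition ascent_bottoms_rl_min (f : nat -> nat) (n : nat) :=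
  forall k j, f k < f k.+1 -> k < j < n -> f k < f j.

Definition ascent_tops_lr_max (f : nat -> nat) (n : nat) :=
  forall k j, k.+1 < n -> f k < f k.+1 -> j <= k -> f j < f k.+1.

Lemma ascent_between (f : nat -> nat) i j :
  i < j -> f i < f j -> exists2 k, i <= k < j & f k < f k.+1.
Proof.
elim: j => // j IHj; rewrite ltnS => le_ij fij.
have [fj|fj] := ltnP (f j) (f j.+1); first by exists j; rewrite ?le_ij /=.
have lt_ij : i < j.
  by rewrite ltn_neqAle le_ij andbT; apply: contraTneq fij => ->; rewrite -leqNgt.
have [|k /andP[ik kj] fk] := IHj lt_ij; first exact: leq_trans fj.
by exists k; rewrite // ik ltnW.
Qed.

Section PermWord.
Variables (n : nat) (s : 'S_n).
Let f := nth 0 (perm_word s).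

Lemma size_perm_word : size (perm_word s) = n.
Proof. by rewrite size_map size_enum_ord. Qed.

Lemma nth_perm_word (i : 'I_n) : nth 0 (perm_word s) i = (s i).+1.
Proof. by rewrite (nth_map i) ?size_enum_ord // nth_ord_enum. Qed.

Lemma nth_perm_word_inj i j : i < n -> j < n -> f i = f j -> i = j.
Proof.
move=> lin ljn; rewrite /f (nth_perm_word (Ordinal lin)).
by rewrite (nth_perm_word (Ordinal ljn)) => -[/val_inj/perm_inj[]].
Qed.

Lemma ltn_perm_word (i j : 'I_n) : (s i < s j) = (f i < f j).
Proof. by rewrite /f !nth_perm_word. Qed.

(** If a letter after the ascent bottom [k] falls below it, the first such letter forms the pattern
    with its predecessor and [k]. Conversely, an ascent between [i] and [j] has its bottom as the
    missing small letter. *)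
Lemma avoid_3_b1_42P :
  ~ contains_3_b1_42 s <-> ascent_bottoms_rl_min f n.
Proof.
split=> [av k j fk /andP[kj jn]|H [i [j [j' [ij j'E /andP[s1 s2] noK]]]]].
- elim/ltn_ind: j kj jn => -[//|j] IHj kj jn.
  rewrite ltnNge; apply/negP => fjk; apply: av.
  have lkj : k < j.
    by rewrite ltn_neqAle -ltnS kj andbT; apply: contraTneq fjk => <-; rewrite -ltnNge.
  have ljn : j < n by exact: ltnW.
  have lkn : k < n by exact: ltn_trans ljn.
  have fkj : f k < f j by exact: IHj.
  have {}fjk : f j.+1 < f k.
    rewrite ltn_neqAle fjk andbT; apply/eqP => /nth_perm_word_inj.
    by move=> /(_ jn lkn) jE; rewrite jE ltnn in kj.
  exists (Ordinal lkn), (Ordinal ljn), (Ordinal jn).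
  rewrite !ltn_perm_word /= fjk fkj; split=> // -[m [/andP[km mj]]].
  rewrite ltn_perm_word /= => fm.
  have := IHj m (ltnW mj) km (ltn_ord m).
  by rewrite ltnNge (ltnW (ltn_trans fm fjk)).
- apply: noK; rewrite !ltn_perm_word in s1 s2 *.
  have [k /andP[ik kj] fk] := ascent_between ij s2.
  have fkj : f k < f j' by apply: H; rewrite // j'E ltnS ltnW //= -j'E.
  exists (Ordinal (ltn_trans kj (ltn_ord j))).
  rewrite ltn_perm_word /= fkj kj andbT ltn_neqAle ik andbT; split=> //.
  by apply: contraTneq (ltn_trans fkj s1) => ->; rewrite ltnn.
Qed.

(** Mirror argument: if a letter up to [k] exceeds the ascent top at [k.+1], the last such letter
    forms the pattern with its successor and that top. Conversely, an ascent between [i'] and [l]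
    has its top as the missing large letter. *)
Lemma avoid_31_b4_2P :
  ~ contains_31_b4_2 s <-> ascent_tops_lr_max f n.
Proof.
split=> [av k j kn fk jk|H [i [i' [l [i'E il /andP[s1 s2] noK]]]]].
- have [d] := ubnP (k - j); elim: d j jk => // d IHd j jk kjd.
  rewrite ltnNge; apply/negP => fjk; apply: av.
  have ljk : j < k.
    by rewrite ltn_neqAle jk andbT; apply: contraTneq fjk => ->; rewrite -ltnNge.
  have lkn : k < n by exact: ltnW.
  have ljn : j < n by exact: ltn_trans lkn.
  have lj1n : j.+1 < n by exact: leq_ltn_trans lkn.
  have {}IHd m : j < m -> m <= k -> f m < f k.+1 by move=> *; apply: IHd; lia.
  have {}fjk : f k.+1 < f j.
    rewrite ltn_neqAle fjk andbT; apply/eqP => /nth_perm_word_inj.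
    by move=> /(_ kn ljn) jE; lia.
  exists (Ordinal ljn), (Ordinal lj1n), (Ordinal kn).
  rewrite !ltn_perm_word /= fjk IHd //; split=> // -[m [/andP[km mj]]].
  rewrite ltn_perm_word /= => fm.
  by have := IHd m (ltnW km) mj; rewrite ltnNge (ltnW (ltn_trans fjk fm)).
- apply: noK; rewrite !ltn_perm_word in s1 s2 *.
  have [k /andP[ik kl] fk] := ascent_between il s1.
  have k1n : k.+1 < n by exact: leq_ltn_trans (ltn_ord l).
  have fik : f i < f k.+1 by apply: H => //; rewrite i'E in ik; exact: ltnW.
  exists (Ordinal k1n).
  rewrite ltn_perm_word /= fik ltnS ik /=; split=> //.
  rewrite ltn_neqAle kl andbT.
  by apply: contraTneq (ltn_trans s2 fik) => ->; rewrite ltnn.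
Qed.

End PermWord.

Lemma avoidersP n (s : 'S_n) : avoiders n s <->
  ascent_bottoms_rl_min (nth 0 (perm_word s)) n /\
  ascent_tops_lr_max (nth 0 (perm_word s)) n.
Proof. by split=> -[/avoid_3_b1_42P ? /avoid_31_b4_2P]. Qed.

(** * Shadowlines *)

Section Topology.
Import Order.TTheory GRing.Theory Num.Theory.
Import numFieldNormedType.Exports.
Local Open Scope classical_set_scope.
Local Open Scope ring_scope.
Variable R : realType.
Implicit Types (p q : R * R) (P : set (R * R)).

Lemma closure_sw_shadow_le P q a :
  (forall p, P p -> p.1 <= a.1 /\ p.2 <= a.2) ->
  closure (\bigcup_(p in P) sw_quarter p) q -> q.1 <= a.1 /\ q.2 <= a.2.
Proof.
move=> Pa qA; suff cl : closed (sw_quarter a).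
  suff : sw_quarter a q by [].
  rewrite (proj1 (closure_id _) cl); apply: closureS qA => r [p /Pa[pa1 pa2] [rp1 rp2]].
  by split; exact: le_trans pa1 || exact: le_trans pa2.
apply: (@closedI _ (fst @^-1` [set x | x <= a.1]) (snd @^-1` [set x | x <= a.2])).
- by apply: preimage_closed (@closed_le _ _) => x _; exact: cvg_fst.
- by apply: preimage_closed (@closed_le _ _) => x _; exact: cvg_snd.
Qed.

Lemma interior_sw_shadow P p q : P p -> q.1 < p.1 -> q.2 < p.2 ->
  interior (\bigcup_(r in P) sw_quarter r) q.
Proof.
move=> Pp q1 q2; exists ([set x | x < p.1], [set x | x < p.2]) => /=.
  by split; exact: lt_nbhsl.
by move=> r [/= r1 r2]; exists p => //; split; exact: ltW.
Qed.

(** This serves to show that a point is not interior: it suffices that no small shift to the right,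
    or none upwards, stays in the set. *)
Lemma interior_shift (A : set (R * R)) q :
  interior A q -> exists2 e, 0 < e & A (q.1 + e, q.2) /\ A (q.1, q.2 + e).
Proof.
move=> [[B1 B2] /= [/nbhs_ballP[e1 e10 B1e] /nbhs_ballP[e2 e20 B2e]] BA].
have e0 : 0 < Num.min e1 e2 / 2 by rewrite divr_gt0 // lt_min; apply/andP.
have [le1 le2] : Num.min e1 e2 / 2 < e1 /\ Num.min e1 e2 / 2 < e2.
  have : Num.min e1 e2 / 2 < Num.min e1 e2 by rewrite gtr_pMr ?invf_lt1 ?ltr1n //; lra.
  by rewrite lt_min => /andP.
exists (Num.min e1 e2 / 2) => //.
split; apply: BA; split => /=.
- by apply: B1e; rewrite /ball /= opprD addNKr normrN gtr0_norm.
- by apply: B2e; exact: ballxx.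
- by apply: B1e; exact: ballxx.
- by apply: B2e; rewrite /ball /= opprD addNKr normrN gtr0_norm.
Qed.

End Topology.

(** * Descending runs *)

(** Counting the ascents before position [i] numbers, from 0, the maximal descending run that
    contains [i]. *)
Definition run_index (f : nat -> nat) (i : nat) := \sum_(k < i) (f k < f k.+1).

Lemma run_indexS f i : run_index f i.+1 = run_index f i + (f i < f i.+1).
Proof. exact: big_ord_recr. Qed.

Lemma leq_run_index f i j : i <= j -> run_index f i <= run_index f j.
Proof.
elim: j => [|j IHj]; first by case: i.
rewrite leq_eqVlt => /predU1P[->//|/IHj ?].
by rewrite run_indexS (leq_trans _ (leq_addr _ _)).
Qed.

Lemma run_index_start f i : 0 < run_index f i ->
  exists m, [/\ m < i, f m < f m.+1 & run_index f i = (run_index f m).+1].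
Proof.
elim: i => [|i IHi]; first by rewrite /run_index big_ord0.
rewrite run_indexS; have [fi _|_] := boolP (f i < f i.+1).
  by exists i; rewrite addn1.
by rewrite addn0 => /IHi[m [mi fm ->]]; exists m; rewrite ltnW.
Qed.

Lemma ascent_run_index f m i : f m < f m.+1 -> m < i ->
  run_index f m < run_index f i.
Proof.
move=> fm mi; apply: leq_trans (leq_run_index f mi).
by rewrite run_indexS fm addn1.
Qed.

(** * Shadowlines of the runs and their crossings *)

Section Levels.
Import Order.TTheory GRing.Theory Num.Theory.
Import numFieldNormedType.Exports.
Local Open Scope classical_set_scope.
Variables (R : realType) (n : nat) (s : 'S_n).
Let f := nth 0 (perm_word s).

Definition perm_point (i : 'I_n) : R * R := ((i.+1)%:R, ((s i).+1)%:R)%R.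

Lemma sw_quarter_perm_point i j :
  sw_quarter (perm_point i) (perm_point j) <-> j <= i /\ s j <= s i.
Proof. by rewrite /sw_quarter /= !ler_nat !ltnS. Qed.

Lemma perm_point_inj : injective perm_point.
Proof.
move=> i j ij; apply/val_inj/eqP; rewrite eqn_leq.
have /sw_quarter_perm_point[-> _] : sw_quarter (perm_point j) (perm_point i).
  by rewrite ij; split.
have /sw_quarter_perm_point[-> //] : sw_quarter (perm_point i) (perm_point j).
by rewrite ij; split.
Qed.

Hypothesis bottoms_min : ascent_bottoms_rl_min f n.

(** Points of one run are incomparable, as the values descend. A point of a run beyond [j] has to
    its southwest the bottom of the ascent that opens its run, which lies in a run of index at least
    [j]. *)
Lemma sw_minimal_runs j :
  sw_minimal (perm_point @` [set i : 'I_n | j <= run_index f i]) =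
  perm_point @` [set i : 'I_n | run_index f i = j].
Proof.
apply/seteqP; split=> [_ [[i /= ji <-] minp]|_ [i /= ri <-]].
- exists i => //=; apply/eqP; rewrite eqn_leq ji andbT leqNgt; apply/negP => {}ji.
  have [m [mi fm rm]] := run_index_start (leq_ltn_trans (leq0n _) ji).
  have mn : m < n := ltn_trans mi (ltn_ord i).
  have /minp/perm_point_inj iE :
      (sw_quarter (perm_point i) `&` perm_point @` [set i : 'I_n | j <= run_index f i])
        (perm_point (Ordinal mn)).
    split; last by exists (Ordinal mn); rewrite //= -ltnS -rm.
    apply/sw_quarter_perm_point; split; first exact: ltnW.
    by rewrite ltnW // ltn_perm_word; apply: bottoms_min; rewrite ?mi /=.
  by rewrite -iE ltnn in mi.
- split; first by exists i => //=; rewrite ri.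
  move=> _ [/[swap] -[k /= jk <-] /sw_quarter_perm_point[ki sk]] /=.
  congr perm_point; apply/val_inj/eqP; rewrite eqn_leq ki leqNgt; apply/negP => lki.
  have fk : f k < f i.
    rewrite -ltn_perm_word ltn_neqAle sk andbT.
    by apply: contraTneq lki => /val_inj/perm_inj ->; rewrite ltnn.
  have [m /andP[km mi] fm] := ascent_between lki fk.
  have := leq_trans jk (leq_run_index f km).
  by rewrite leqNgt -ri ascent_run_index.
Qed.

Lemma unused_points_runs j :
  @unused_points R n s j = perm_point @` [set i : 'I_n | j <= run_index f i].
Proof.
elim: j => [|j IHj]; first by apply/seteqP; split=> _ [i _ <-]; exists i.
rewrite /unused_points iterS [iter _ _ _]IHj sw_minimal_runs.
apply/seteqP; split=> [_ [[i /= ji <-] nri]|_ [i /= ji <-]].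
- exists i => //=; rewrite ltn_neqAle ji andbT; apply/eqP => jE.
  by apply: nri; exists i.
- split; first by exists i => //=; exact: ltnW.
  by move=> [k /= rk /perm_point_inj kE]; rewrite -rk kE ltnn in ji.
Qed.

Lemma sw_diagram0_runs j :
  @sw_diagram0 R n s j = sw_shadowline (perm_point @` [set i : 'I_n | run_index f i = j]).
Proof. by rewrite /sw_diagram0 unused_points_runs sw_minimal_runs. Qed.

Lemma noncrossing_ascent_tops :
  noncrossing_sw_diagram0 R s -> ascent_tops_lr_max f n.
Proof.
move=> nc k j kn fk jk; rewrite ltnNge; apply/negP => fkj.
have jn : j < n by exact: leq_ltn_trans jk (ltnW kn).
have fkj' : f k.+1 < f j.
  rewrite ltn_neqAle fkj andbT; apply/eqP => /nth_perm_word_inj.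
  by move=> /(_ kn jn) jE; rewrite -jE ltnn in jk.
have rjk : run_index f j < run_index f k.+1.
  by rewrite run_indexS fk addn1 ltnS leq_run_index.
(* [t] opens its run, and [a] below is the last point of the run of [j] higher than [t]. The
   shadowlines meet straight below [a], at the height of [t]. *)
pose t := Ordinal kn.
pose D l := (run_index f l == run_index f j) && (f t < f l).
have Dj : D (Ordinal jn) by rewrite /D /= eqxx.
have [a /andP[/eqP ra fa] maxa] :=
  @arg_maxnP _ (Ordinal jn) (fun l : 'I_n => D l) (fun l => l : nat) Dj.
have ak : a <= k.
  by rewrite leqNgt; apply/negP => /(leq_run_index f); rewrite ra leqNgt rjk.
have /seteqP[+ _] := nc (run_index f j) (run_index f t) (elimF eqP (ltn_eqF rjk)).
move=> /(_ ((perm_point a).1, (perm_point t).2)); apply.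
rewrite !sw_diagram0_runs; split; split.
- apply: subset_closure; exists (perm_point a); first by exists a.
  by split=> //=; rewrite ler_nat !ltnS; apply: ltnW; rewrite ltn_perm_word.
(* A shift to the right would need a later point of the same run, not lower than [t], against the
   choice of [a]. *)
- move=> /interior_shift[e e0 [[_ [l /= rl <-] [/= xl yl]] _]].
  have al : a < l by rewrite -ltnS -(ltr_nat R); apply: lt_le_trans xl; rewrite ltrDl.
  have tl : f t <= f l by rewrite leqNgt -ltn_perm_word -leqNgt -ltnS -(ler_nat R).
  have t_l : t != l by apply/eqP => tE; move: rjk; rewrite -rl -tE /= ltnn.
  suff /maxa : D l by rewrite /= leqNgt al.
  rewrite /D rl eqxx /= ltn_neqAle tl andbT.
  apply: contraNneq t_l => /nth_perm_word_inj tE.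
  by apply/eqP/val_inj/tE.
- apply: subset_closure; exists (perm_point t); first by exists t.
  by split=> //=; rewrite ler_nat ltnS leqW.
(* A shift upwards would need a point in the run of [t] higher than [t], the first and highest point
   of that run. *)
- move=> /interior_shift[e e0 [_ [_ [l /= rl <-] [/= xl yl]]]].
  have tl : f t < f l.
    by rewrite -ltn_perm_word -ltnS -(ltr_nat R); apply: lt_le_trans yl; rewrite ltrDl.
  have [lk|] := leqP l k.
    have := leq_run_index f lk.
    by rewrite leqNgt rl run_indexS fk addn1 leqnn.
  rewrite leq_eqVlt => /predU1P[lE|]; first by rewrite -lE ltnn in tl.
  move=> /ascent_between/(_ tl)[m /andP[km ml] fm].
  have := leq_run_index f km.
  by rewrite /= -rl leqNgt ascent_run_index.
Qed.

Lemma ascent_tops_noncrossing :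
  ascent_tops_lr_max f n -> noncrossing_sw_diagram0 R s.
Proof.
move=> tops_max.
suff nc j k : j < k -> @sw_diagram0 R n s j `&` @sw_diagram0 R n s k = set0.
  move=> j k /eqP; rewrite neq_ltn => /orP[|] /nc //.
  by rewrite setIC.
move=> jk; rewrite !sw_diagram0_runs; apply/seteqP; split=> // q [[qj _] [qk nqk]].
(* Beyond the last run the shadow is empty, and so is its closure. *)
have [i ri] : exists i : 'I_n, run_index f i = k.
  apply: contrapT => /forallNP none.
  move: qk; rewrite (_ : _ @` _ = set0) ?bigcup_set0 ?closure0 //.
  by apply/seteqP; split=> // p [i /none].
have r0 : 0 < run_index f i by rewrite ri; exact: leq_ltn_trans jk.
have [m [mi fm rm]] := run_index_start r0.
have m1n : m.+1 < n := leq_ltn_trans mi (ltn_ord i).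
pose t := Ordinal m1n.
(* Passing to the closure keeps only weak inequalities. Coordinates are integers, so strict
   inequalities leave a gap of 1, which survives. *)
have [q1 q2] : (q.1 <= (perm_point t).1 - 1 /\ q.2 <= (perm_point t).2 - 1)%R.
  pose a := ((perm_point t).1 - 1, (perm_point t).2 - 1)%R.
  apply: (@closure_sw_shadow_le _ _ _ a _ qj).
  move=> _ [l /= rl <-] /=.
  have lm : l <= m.
    rewrite leqNgt; apply/negP => ml.
    have := leq_run_index f ml.
    by rewrite run_indexS fm addn1 -rm ri rl leqNgt jk.
  have sl : s l < s t by rewrite ltn_perm_word; exact: tops_max.
  by split; rewrite lerBrDr natr1 ler_nat ltnS.
apply: nqk; apply: (@interior_sw_shadow _ _ (perm_point t)).
- by exists t => //=; rewrite run_indexS fm addn1 -rm.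
- by apply: le_lt_trans q1 _; rewrite ltrBlDr ltrDl ltr01.
- by apply: le_lt_trans q2 _; rewrite ltrBlDr ltrDl ltr01.
Qed.

End Levels.

(** * Patience sorting *)

Definition pile_top (rs : seq nat * seq nat) := head 0 rs.1.
Definition is_stack (rs : seq nat * seq nat) := (0 < size rs.1) && sorted ltn rs.1.

(** A word given by a function and a length allows induction on its prefixes. *)
Definition patience (f : nat -> nat) (m : nat) :=
  foldl (fun P i => place (f i) i.+1 P) [::] (iota 0 m).

Lemma patienceS f m : patience f m.+1 = place (f m) m.+1 (patience f m).
Proof. by rewrite /patience -addn1 iotaD foldl_cat addn1. Qed.

Lemma ext_patienceE n (s : 'S_n) : ext_patience s = patience (nth 0 (perm_word s)) n.
Proof.
rewrite /ext_patience /patience -val_enum_ord.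
elim: (enum _) [::] => //= i e IHe P.
by rewrite nth_perm_word IHe.
Qed.

Lemma all_top_place b c i P : b <= c -> all (fun rs => b <= pile_top rs) P ->
  all (fun rs => b <= pile_top rs) (place c i P).
Proof.
move=> bc; elim: P => [|rs P IHP] /=; first by rewrite /pile_top bc.
by move=> /andP[brs bP]; case: ifP => _ /=; rewrite ?bc ?brs ?IHP ?bP.
Qed.

Lemma place_stack c i P : all is_stack P -> all is_stack (place c i P).
Proof.
elim: P => //= -[r q] P IHP /andP[srs sP];
  case: ifP => /= [cr|_]; last by rewrite srs IHP.
rewrite sP andbT; case/andP: srs cr; case: r => //= a r _ ar.
by rewrite /is_stack /= => ->.
Qed.

(** The tops to the left of the chosen pile are at most the new card, and those to the right are at
    least the top that it covers, which is larger than the card. *)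
Lemma place_tops c i P : pairwise (relpre pile_top leq) P ->
  pairwise (relpre pile_top leq) (place c i P).
Proof.
elim: P => //= rs P IHP /andP[rsP /[dup] topP /IHP topP'].
case: ifP => [crs|/negbT]; rewrite /= ?topP ?topP' andbT.
  by apply: sub_all rsP => rs'; apply: leq_trans; exact: ltnW.
by rewrite -leqNgt => crs; apply: all_top_place.
Qed.

Lemma place_rcons c i P rs : all (fun rs => pile_top rs <= c) P ->
  place c i (rcons P rs) = if c < pile_top rs then rcons P (c :: rs.1, i :: rs.2)
                           else rcons (rcons P rs) ([:: c], [:: i]).
Proof.
elim: P => [|rs' P IHP] /=; first by case: ifP.
rewrite ltnNge => /andP[-> /IHP -> /=]; by case: ifP.
Qed.

Lemma sort_geq_stack p : sorted ltn p -> sort geq p = rev p.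
Proof.
move=> sp; have geqT : total geq by move=> x y; exact: leq_total.
apply: (sorted_eq (leT := geq)).
- by move=> x y z /[swap]; exact: leq_trans.
- by move=> x y /andP[? ?]; apply/eqP; rewrite eqn_leq; apply/andP.
- exact: sort_sorted.
- by rewrite rev_sorted; apply: sub_sorted sp => x y /ltnW.
- by rewrite perm_sort perm_sym perm_rev.
Qed.

(** * Ascents of reverse patience words *)

(** The inequality is weak because letters may repeat here; for permutations injectivity restores
    strictness. The default 0 past the end creates no ascent. *)
Definition seq_bottoms_min (w : seq nat) :=
  forall k j, nth 0 w k < nth 0 w k.+1 -> k < j < size w -> nth 0 w k <= nth 0 w j.

Lemma seq_bottoms_min_cons a w : (a < head 0 w -> all (leq a) w) ->
  seq_bottoms_min w -> seq_bottoms_min (a :: w).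
Proof.
move=> aw Hw [|k] [|j] //=; last exact: Hw.
by rewrite nth0 => /aw/all_nthP aw' /aw'; apply.
Qed.

Lemma seq_bottoms_min_cat a p w : path gtn a p -> all (leq (last a p)) w ->
  seq_bottoms_min w -> seq_bottoms_min (a :: p ++ w).
Proof.
elim: p a => [|b p IHp] a /=; first by move=> _ aw; exact: seq_bottoms_min_cons.
move=> /andP[ba pp] pw Hw; apply: seq_bottoms_min_cons; last exact: IHp.
by rewrite /= ltnNge (ltnW ba).
Qed.

(** Ascents occur only where one pile ends and another begins. The bottom of such an ascent is the
    top of its pile, hence at most all later tops, each of which is the least card of its pile. *)
Lemma RPW_bottoms_min P : all is_stack P -> pairwise (relpre pile_top leq) P ->
  seq_bottoms_min (RPW [seq rs.1 | rs <- P]).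
Proof.
elim: P => [_ _ k j|[r q] P IHP] /=; first by rewrite !nth_nil.
move=> /andP[/andP[r0 sr] sP] /andP[rP /IHP{}IHP].
rewrite /RPW /= sort_geq_stack //.
case: (lastP r) r0 sr rP => // r' x _ sr rP.
have rvE : rev (rcons r' x) = x :: rev r' by rewrite rev_rcons.
rewrite rvE; apply: seq_bottoms_min_cat; last exact: IHP.
- by rewrite -[path _ _ _]/(sorted gtn (x :: rev r')) -rvE rev_sorted.
- rewrite -[last _ _]/(last 0 (x :: rev r')) -rvE.
  rewrite (_ : last 0 _ = pile_top (rcons r' x, q)); last first.
    by rewrite /pile_top; case: (r') => //= y r''; rewrite rev_cons last_rcons.
  apply/allP => y /flattenP[_ /mapP[_ /mapP[rs rsP ->] ->]].
  rewrite mem_sort => yrs; apply: leq_trans (allP rP _ rsP) _.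
  have /andP[_ srs] := allP sP _ rsP.
  rewrite /pile_top; case: (rs.1) yrs srs => //= z r''.
  rewrite inE => /predU1P[->//|yr''].
  by move=> /(order_path_min ltn_trans)/allP/(_ _ yr'')/ltnW.
Qed.

Lemma patience_stacks f m :
  all is_stack (patience f m) /\ pairwise (relpre pile_top leq) (patience f m).
Proof.
elim: m => // m [IHs IHt]; rewrite patienceS.
by split; [exact: place_stack|exact: place_tops].
Qed.

Lemma reverse_patience_word_bottoms_min n (s : 'S_n) :
  reverse_patience_word s -> ascent_bottoms_rl_min (nth 0 (perm_word s)) n.
Proof.
move=> [t sE] k j fk /andP[kj jn].
have {sE} : seq_bottoms_min (perm_word s).
  rewrite sE /Rpiles ext_patienceE.
  have [stackP topsP] := patience_stacks (nth 0 (perm_word t)) n.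
  exact: RPW_bottoms_min.
move=> /(_ k j fk); rewrite size_perm_word kj jn => /(_ isT).
rewrite leq_eqVlt => /predU1P[/nth_perm_word_inj kE|//].
by have kn := ltn_trans kj jn; rewrite (kE kn jn) ltnn in kj.
Qed.

(** * Bottom rows under one step *)

Lemma bottom_row_push P c p : pairwise ltn (bottom_row (rcons P p)) ->
  pairwise ltn (bottom_row (rcons P (c :: p))).
Proof.
rewrite /bottom_row !map_rcons !pairwise_rcons => /andP[Pp ->]; rewrite andbT.
by apply: sub_all Pp => x; rewrite /= big_cons leq_max => ->; rewrite orbT.
Qed.

Lemma bottom_row_new P c : 0 < c -> {in flatten P, forall x, x < c} ->
  pairwise ltn (bottom_row P) -> pairwise ltn (bottom_row (rcons P [:: c])).
Proof.
move=> c0 Pc; rewrite /bottom_row map_rcons pairwise_rcons => ->; rewrite andbT.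
apply/allP => _ /mapP[p pP ->]; rewrite /= big_seq1 -(prednK c0) ltnS.
apply/bigmax_leqP_seq => x xp _; rewrite -ltnS (prednK c0); apply: Pc.
by apply/flattenP; exists p.
Qed.

Lemma mem_place c i P :
  {subset flatten (unzip1 (place c i P)) <= c :: flatten (unzip1 P)} /\
  {subset flatten (unzip2 (place c i P)) <= i :: flatten (unzip2 P)}.
Proof.
elim: P => [|rs P [IH1 IH2]] /=; first by split.
case: ifP => _ /=; first by split.
split=> x; rewrite mem_cat inE mem_cat => /orP[->|]; rewrite ?orbT //.
- by move/IH1; rewrite inE => /orP[->//|->]; rewrite !orbT.
- by move/IH2; rewrite inE => /orP[->//|->]; rewrite !orbT.
Qed.

Lemma mem_patience f m :
  {subset flatten (unzip1 (patience f m)) <= mkseq f m} /\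
  {subset flatten (unzip2 (patience f m)) <= iota 1 m}.
Proof.
elim: m => // m [IH1 IH2]; rewrite patienceS.
have [sub1 sub2] := mem_place (f m) m.+1 (patience f m).
split=> x.
- move/sub1; rewrite inE => /predU1P[->|/IH1/mapP[j]].
    by apply: map_f; rewrite mem_iota ltnSn.
  rewrite mem_iota => /andP[_ jm] ->; apply: map_f.
  by rewrite mem_iota /= ltnS ltnW.
- move/sub2; rewrite inE => /predU1P[->|/IH2]; rewrite !mem_iota !add1n ?ltnSn //.
  by move=> /andP[-> xm]; rewrite leqW.
Qed.

(** * Patience sorting run by run *)

Section Runs.
Variables (f : nat -> nat) (n : nat).
Hypothesis f_inj : forall i j, i < n -> j < n -> f i = f j -> i = j.
Hypothesis bottoms_min : ascent_bottoms_rl_min f n.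

(** All piles but the last have tops below every remaining letter, so a descent extends the last
    pile and an ascent opens a new one. *)
Lemma patience_step m : m.+1 < n -> exists P r q,
  patience f m.+1 = rcons P (f m :: r, m.+1 :: q) /\
  ((f m.+1 < f m /\
    patience f m.+2 = rcons P (f m.+1 :: f m :: r, m.+2 :: m.+1 :: q)) \/
   (f m < f m.+1 /\
    patience f m.+2 = rcons (patience f m.+1) ([:: f m.+1], [:: m.+2]))).
Proof.
move=> mn.
suff [P [r [q [pE Plt]]]] : exists P r q,
    patience f m.+1 = rcons P (f m :: r, m.+1 :: q) /\
    forall rs j, rs \in P -> m < j < n -> pile_top rs < f j.
  exists P, r, q; split=> //; rewrite (patienceS f m.+1) pE place_rcons; last first.
    by apply/allP => rs rsP; apply: ltnW; apply: Plt; rewrite ?ltnSn.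
  rewrite [pile_top _]/=; case: ltnP => fm; [by left|right; split=> //].
  rewrite ltn_neqAle fm andbT; by apply/eqP => /(f_inj (ltnW mn) mn)/n_Sn.
elim: m mn => [_|m IHm mn]; first by exists [::], [::], [::].
have [P [r [q [pE Plt]]]] := IHm (ltnW mn).
rewrite patienceS pE place_rcons; last first.
  by apply/allP => rs rsP; apply: ltnW; apply: Plt; rewrite ?ltnSn //= ltnW.
rewrite [pile_top _]/=; case: ifP => [_|/negbT].
  exists P, (f m :: r), (m.+1 :: q); split=> // rs j rsP /andP[/ltnW mj jn].
  by apply: Plt; rewrite ?mj.
rewrite -leqNgt => fm.
exists (rcons P (f m :: r, m.+1 :: q)), [::], [::]; split=> // rs j.
rewrite mem_rcons inE => /predU1P[->|rsP] /andP[/ltnW mj jn]; last first.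
  by apply: Plt; rewrite ?mj.
(* When a new pile opens, the previous last pile is closed with an ascent bottom on top, which is
   below all that follows. *)
apply: bottoms_min; rewrite ?mj // ltn_neqAle fm andbT.
by apply/eqP => /(f_inj (ltnW (ltnW mn)) (ltnW mn))/n_Sn.
Qed.

Lemma flatten_patience m : m <= n ->
  flatten [seq rev p | p <- unzip1 (patience f m)] = mkseq f m.
Proof.
case: m => // m; elim: m => // m IHm mn.
have := IHm (ltnW mn); have [P [r [q [-> [[_ ->]|[_ ->]]]]]] := patience_step mn.
- rewrite /unzip1 !map_rcons !flatten_rcons /= !(rev_cons (f m.+1)) -rcons_cat.
  by move=> ->; rewrite [RHS]mkseqS.
- by rewrite /unzip1 !map_rcons !flatten_rcons /= => ->; rewrite cats1 [RHS]mkseqS.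
Qed.

(** A new pile starts with an index larger than all the indices placed before. *)
Lemma bottom_row_unzip2 m : m <= n ->
  pairwise ltn (bottom_row (unzip2 (patience f m))).
Proof.
case: m => // m; elim: m => // m IHm mn.
have := IHm (ltnW mn); have [P [r [q [pE [[_ ->]|[_ ->]]]]]] := patience_step mn.
- by rewrite pE /unzip2 !map_rcons; exact: bottom_row_push.
- rewrite [in X in _ -> X]/unzip2 map_rcons; apply: bottom_row_new => // x.
  by move=> /(proj2 (mem_patience f m.+1)); rewrite mem_iota => /andP[_].
Qed.

(** A new pile starts with an ascent top, which exceeds every earlier card. *)
Lemma bottom_row_unzip1 m : (forall i, i < n -> 0 < f i) ->
  ascent_tops_lr_max f n -> m <= n ->
  pairwise ltn (bottom_row (unzip1 (patience f m))).
Proof.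
move=> f0 tops_max; case: m => // m; elim: m => // m IHm mn.
have := IHm (ltnW mn); have [P [r [q [pE [[_ ->]|[fm ->]]]]]] := patience_step mn.
- by rewrite pE /unzip1 !map_rcons; exact: bottom_row_push.
- rewrite [in X in _ -> X]/unzip1 map_rcons; apply: bottom_row_new; first exact: f0.
  move=> x /(proj1 (mem_patience f m.+1))/mapP[j]; rewrite mem_iota ltnS => jm ->.
  exact: tops_max.
Qed.

End Runs.

(** * The characterization and the bottom rows *)

Lemma bottoms_min_reverse_patience_word n (s : 'S_n) :
  ascent_bottoms_rl_min (nth 0 (perm_word s)) n -> reverse_patience_word s.
Proof.
(* The permutation is its own witness: its piles are its descending runs, in order. *)
move=> bottoms_min; exists s.
rewrite /RPW /Rpiles ext_patienceE.
have [/allP stackP _] := patience_stacks (nth 0 (perm_word s)) n.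
rewrite (_ : [seq sort geq p | p <- _] =
             [seq rev p | p <- unzip1 (patience (nth 0 (perm_word s)) n)]); last first.
  rewrite -!map_comp; apply/eq_in_map => rs /stackP/andP[_].
  exact: sort_geq_stack.
rewrite (flatten_patience _ bottoms_min (leqnn n)); last exact: nth_perm_word_inj.
by rewrite -{1}(mkseq_nth 0 (perm_word s)) size_perm_word.
Qed.

Lemma avoiders_bottom_rows n (s : 'S_n) : avoiders n s ->
  sorted ltn (bottom_row (Rpiles s)) /\ sorted ltn (bottom_row (Spiles s)).
Proof.
move=> /avoidersP[bottoms_min tops_max].
rewrite !(sorted_pairwise ltn_trans) /Rpiles /Spiles ext_patienceE; split.
- apply: (bottom_row_unzip1 _ bottoms_min _ tops_max (leqnn n)) => [|i lin].
    exact: nth_perm_word_inj.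
  by rewrite (nth_perm_word s (Ordinal lin)).
- by apply: (bottom_row_unzip2 _ bottoms_min (leqnn n)); exact: nth_perm_word_inj.
Qed.

Theorem mainTheorem12 (R : realType) (n : nat) :
  avoiders n =
    [set s : 'S_n | reverse_patience_word s /\ noncrossing_sw_diagram0 R s]%classic
  /\
  (forall s : 'S_n, avoiders n s ->
     sorted ltn (bottom_row (Rpiles s)) /\ sorted ltn (bottom_row (Spiles s))).
Proof.
split; last exact: avoiders_bottom_rows.
apply/seteqP; split=> [s /avoidersP[bottoms tops]|s [rpw nc]].
  split; first exact: bottoms_min_reverse_patience_word.
  exact: ascent_tops_noncrossing.
have bottoms := reverse_patience_word_bottoms_min rpw.
by apply/avoidersP; split=> //; exact: (noncrossing_ascent_tops bottoms nc).
Qed.
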